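(* Let $G$ be a finite simple connected graph with $n$ vertices, equipped with a closed labeling $V(G)=[n]$, and let $E_1<E_2<\cdots<E_r$ be its exchangeability equivalence classes, ordered so that for $i\in E_a$ and $j\in E_b$ we have $i<j$ if and only if $a<b$. Let $G/\!\sim$ be the graph with vertex set $\{E_1,\dots,E_r\}$ in which $\{E_a,E_b\}$ (with $a\neq b$) is an edge if and only if $\{i,j\}\in E(G)$ for some $i\in E_a$, $j\in E_b$. Then: (1) $G/\!\sim$ is connected, collapsed, and closed with respect to the labeling $E_a\mapsto a$. (2) If $r>1$, then $G$ has precisely $2\prod_{a=1}^r |E_a|!$ closed labelings.
   Context: All graphs are finite and simple. A labeling of a graph $G$ with $n$ vertices is a bijection $V(G)\to[n]=\{1,\dots,n\}$; given a labeling we identify $V(G)=[n]$. A labeling is closed if whenever $\{j,i\},\{i,k\}\in E(G)$ with $j\neq k$ and either $j>i<k$ or $j<i>k$, then $\{j,k\}\in E(G)$. A graph is closed if it has a closed labeling. The full neighborhood of a vertex $v$ is $N_G[v]=\{v\}\cup N_G(v)$, where $N_G(v)$ is the set of neighbors of $v$. Vertices $v,w$ are exchangeable, $v\sim w$, if $N_G[v]=N_G[w]$; this is an equivalence relation. A graph is collapsed if $N_G[v]=N_G[w]$ implies $v=w$. For a connected graph with a closed labeling, each equivalence class of $\sim$ is an interval $\{k: i\le k\le j\}$ of $[n]$, which is what makes the ordering $E_1<\cdots<E_r$ well defined. *)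

(* Defs.v *)
From mathcomp Require Import all_boot.

Set Implicit Arguments.
Unset Strict Implicit.
Unset Printing Implicit Defensive.

Record sgraph := SGraph {
  vertex :> finType;
  adj : rel vertex;
  adj_sym : symmetric adj;
  adj_irr : irreflexive adj
}.

(* The empty graph is not counted as connected. *)
Definition connected (G : sgraph) : bool :=
  (0 < #|G|) && [forall v : G, forall w : G, connect (@adj G) v w].

Section Graph.

Variable G : sgraph.

(* The labels are 0, .., n-1 rather than 1, .., n; only their order is used. *)
Definition labeling (n : nat) (f : G -> 'I_n) : bool :=
  injectiveb f && [forall k : 'I_n, exists v : G, f v == k].

Definition closed_labeling (n : nat) (f : G -> 'I_n) : bool :=
  labeling f &&
  [forall i : G, forall j : G, forall k : G,
     [&& adj j i, adj i k, j != k &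
         ((f i < f j) && (f i < f k)) || ((f j < f i) && (f k < f i))]
     ==> adj j k].

Definition nbhd (v : G) : {set G} := [set w | adj v w].

Definition full_nbhd (v : G) : {set G} := v |: nbhd v.

Definition exchangeable : rel G := [rel v w | full_nbhd v == full_nbhd w].

Definition collapsed : Prop :=
  forall v w : G, full_nbhd v = full_nbhd w -> v = w.

Definition exch_classes : {set {set G}} :=
  equivalence_partition exchangeable [set: G].

Definition exch_class : finType := {A : {set G} | A \in exch_classes}.

Definition class_set (A : exch_class) : {set G} := sval A.

Definition quotient_adj : rel exch_class :=
  fun A B => (A != B) &&
    [exists i in class_set A, exists j in class_set B, adj i j].

Lemma quotient_adj_sym : symmetric quotient_adj.
Proof.
move=> A B; rewrite /quotient_adj eq_sym; congr (_ && _).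
by apply/exists_inP/exists_inP => -[i iA /exists_inP[j jB ij]];
  exists j => //; apply/exists_inP; exists i => //; rewrite adj_sym.
Qed.

Lemma quotient_adj_irr : irreflexive quotient_adj.
Proof. by move=> A; rewrite /quotient_adj eqxx. Qed.

Definition quotient_graph : sgraph := SGraph quotient_adj_sym quotient_adj_irr.

End Graph.

(* Main.v *)
(* A closed labeling of a connected graph has the umbrella property: an edge
   [u w] makes every vertex labeled between [u] and [w] adjacent to both, because
   any two vertices are joined by a label-monotone path.  Consequently, when [u]
   is fixed, a connected set of vertices outside the full neighborhood of [u] lies
   on one side of [u] in every closed labeling.  Moving the two ends of a
   non-adjacent pair outward along monotone paths, its orientation agrees with
   that of the extremal vertices, and an adjacent non-exchangeable pair gets its
   orientation from an induced path on three vertices.  Hence two closed labelings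
   induce the same or opposite orders on non-exchangeable pairs; those inducing
   the same order as [phi] are the compositions of [phi] with the permutations
   preserving every exchangeability class. *)

Require Import Defs.
From mathcomp Require Import all_boot all_fingroup.

Set Implicit Arguments.
Unset Strict Implicit.
Unset Printing Implicit Defensive.

(** * Permutations preserving the fibers of a map *)

Section FiberPerms.

Variables (T I : finType) (c : T -> I).

(** The list [s] names the fibers on which points may move, which allows induction on [s]. *)
Definition fiber_perms (s : seq I) : {set {perm T}} :=
  [set p : {perm T} | [forall x,
     (c (p x) == c x) && ((c x \in s) || (p x == x))]].

Lemma fiber_permsP (s : seq I) (p : {perm T}) :
  reflect (forall x, c (p x) = c x /\ (c x \notin s -> p x = x))
          (p \in fiber_perms s).
Proof.
rewrite inE; apply: (iffP forallP) => [h x|h x].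
  by have /andP[/eqP-> /orP[-> //|/eqP]] := h x.
have [-> hx] := h x; rewrite eqxx /=.
by have [//|/hx->] := boolP (c x \in s); rewrite eqxx.
Qed.

Lemma group_set_fiber_perms (s : seq I) : group_set (fiber_perms s).
Proof.
apply/group_setP; split.
  by apply/fiber_permsP => x; rewrite perm1.
move=> p q /fiber_permsP hp /fiber_permsP hq; apply/fiber_permsP => x.
rewrite permM; have [cp fp] := hp x; have [cq fq] := hq (p x).
split; first by rewrite cq.
by move=> xs; rewrite fq ?cp // fp.
Qed.

Canonical fiber_perms_group (s : seq I) := Group (group_set_fiber_perms s).

(** A fiber-preserving [p] splits into its restriction [q] to the fiber over [a], extended by the
    identity, and [q^-1 * p], which fixes that fiber pointwise. *)
Lemma fiber_perms_cons (a : I) (s : seq I) :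
  fiber_perms (a :: s) = (Sym [set x | c x == a] * fiber_perms s)%g.
Proof.
set F := [set x | c x == a]; apply/setP => p; apply/idP/idP.
  move/fiber_permsP=> hp.
  have nF : p \in 'N(F | 'P)%g.
    by apply/astabsP => x; rewrite !inE /aperm /= (hp x).1.
  set q := restr_perm F p.
  have qS : perm_on F q by apply: restr_perm_on.
  have cq x : c (q x) = c x.
    have [xF|xF] := boolP (x \in F); last by rewrite (out_perm qS).
    by rewrite restr_permE // (hp x).1.
  apply/mulsgP; exists q (q^-1 * p)%g; [by rewrite inE| |by rewrite mulKVg].
  apply/fiber_permsP => x; rewrite permM.
  have cqV y : c (q^-1 y)%g = c y by rewrite -{2}(permKV q y) cq.
  split; first by rewrite (hp _).1 cqV.
  move=> xs; have [xF|xF] := boolP (x \in F).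
    rewrite -(@restr_permE _ F p (q^-1 x)%g nF); first by rewrite permKV.
    by move: xF; rewrite !inE cqV.
  have -> : (q^-1 x)%g = x.
    by apply: (perm_inj (s := q)); rewrite permKV (out_perm qS).
  apply: (hp x).2; rewrite inE (negbTE xs) orbF.
  by move: xF; rewrite inE.
case/mulsgP => q t; rewrite inE => qS /fiber_permsP ht ->.
apply/fiber_permsP => x; rewrite permM (ht _).1; split.
  have [xF|xF] := boolP (x \in F); last by rewrite (out_perm qS).
  have : q x \in F by rewrite perm_closed.
  by move: xF; rewrite !inE => /eqP-> /eqP->.
rewrite inE negb_or => /andP[xa xs].
by rewrite (out_perm qS) ?inE // (ht x).2.
Qed.

Lemma card_fiber_perms_seq (s : seq I) : uniq s ->
  #|fiber_perms s| = \prod_(a <- s) #|[set x | c x == a]|`!.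
Proof.
elim: s => [_|a s IHs /= /andP[as_ us]].
  rewrite big_nil; apply/eqP/cards1P; exists 1%g; apply/setP => p.
  rewrite in_set1; apply/idP/eqP => [/fiber_permsP hp|->]; last exact: group1.
  by apply/permP => x; rewrite perm1 (hp x).2.
(* Since [a] is not in [s], the two factors intersect trivially, so cardinalities multiply. *)
rewrite big_cons -(IHs us) -card_Sym fiber_perms_cons TI_cardMg //.
apply/trivgP/subsetP => p /setIP[]; rewrite [p \in Sym _]inE => pS /fiber_permsP hp.
rewrite inE; apply/eqP/permP => x; rewrite perm1.
have [/eqP xa|xF] := boolP (c x == a); first by rewrite (hp x).2 ?xa.
by rewrite (out_perm pS) ?inE.
Qed.

Lemma card_fiber_perms :
  #|[set p : {perm T} | [forall x, c (p x) == c x]]|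
    = \prod_(a : I) #|[set x | c x == a]|`!.
Proof.
rewrite -[RHS]big_filter filter_predT -card_fiber_perms_seq ?index_enum_uniq //.
congr #|pred_of_set _|; apply/setP => p; rewrite !inE.
by apply: eq_forallb => x; rewrite mem_index_enum andbT.
Qed.

End FiberPerms.

(* If the labels coincide but [c u < c v], then [f] has fewer labels up to
   [g v] than [g] does. *)
Lemma monotone_bij_fiber (T : finType) (n : nat) (f g : T -> 'I_n)
    (c : T -> nat) : bijective f -> bijective g ->
  (forall u v, c u < c v -> f u < f v) ->
  (forall u v, c u < c v -> g u < g v) ->
  forall u v, f u = g v -> c u = c v.
Proof.
move=> bf bg; wlog suff H: f g bf bg / forall u v,
    (forall u v, c u < c v -> f u < f v) ->
    (forall u v, c u < c v -> g u < g v) -> f u = g v -> c v <= c u.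
  move=> mf mg u v e; apply/eqP; rewrite eqn_leq.
  by rewrite (H g f bg bf v u) // (H f g bf bg u v).
move=> u v mf mg e; rewrite leqNgt; apply/negP => ltc.
pose R := [set i : 'I_n | i <= g v].
have /eqP : #|f @^-1: R| = #|g @^-1: R|.
  by rewrite !on_card_preimset //; apply: onW_bij.
have vR : v \in g @^-1: R by rewrite !inE.
suff sub : f @^-1: R \subset (g @^-1: R) :\ v.
  by rewrite (cardsD1 v (g @^-1: R)) vR eqn_leq add1n (leqNgt _.+1)
    ltnS (subset_leq_card sub) andbF.
apply/subsetP => x; rewrite !inE -e => lex.
have ltx : c x < c v.
  by apply: leq_ltn_trans ltc; rewrite leqNgt; apply/negP => /mf; rewrite ltnNge lex.
rewrite e (ltnW (mg _ _ ltx)) andbT.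
by apply: contraTneq ltx => ->; rewrite ltnn.
Qed.

(** * Basic properties of closed labelings *)

Section ClosedLabelings.

Variables (G : sgraph) (n : nat).
Implicit Types (f g : G -> 'I_n) (u v w : G).

Lemma labeling_bij f : labeling f -> bijective f.
Proof.
case/andP => /injectiveP inj_f /forallP surj_f.
apply: inj_card_bij => //; rewrite -(card_codom inj_f) subset_leq_card //.
apply/subsetP => k _; have /existsP[v /eqP <-] := surj_f k.
exact: codom_f.
Qed.

Lemma bij_labeling f : bijective f -> labeling f.
Proof.
move=> bf; apply/andP; split; first exact/injectiveP/bij_inj.
by have [h _ hK] := bf; apply/forallP => k; apply/existsP; exists (h k); rewrite hK.
Qed.

Lemma closed_bij f : closed_labeling f -> bijective f.
Proof. by case/andP => /labeling_bij. Qed.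

Lemma closed_ltNge f u v :
  closed_labeling f -> u != v -> (f u < f v) = ~~ (f v < f u).
Proof.
move=> /closed_bij/bij_inj inj_f uv; rewrite -leqNgt [RHS]leq_eqVlt.
by rewrite [_ == _ :> nat](inj_eq inj_f) (negbTE uv).
Qed.

Lemma closed_above f u v w : closed_labeling f -> adj u v -> adj u w ->
  v != w -> f u < f v -> f u < f w -> adj v w.
Proof.
move=> /andP[_ /forallP/(_ u)/forallP/(_ v)/forallP/(_ w)/implyP H] uv uw vw lv lw.
by apply: H; rewrite adj_sym uv uw vw lv lw.
Qed.

Lemma closed_below f u v w : closed_labeling f -> adj u v -> adj u w ->
  v != w -> f v < f u -> f w < f u -> adj v w.
Proof.
move=> /andP[_ /forallP/(_ u)/forallP/(_ v)/forallP/(_ w)/implyP H] uv uw vw lv lw.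
by apply: H; rewrite adj_sym uv uw vw lv lw orbT.
Qed.

Lemma closed_labelingP f : labeling f ->
  (forall u v w, adj u v -> adj u w -> v != w ->
     (f u < f v) && (f u < f w) || (f v < f u) && (f w < f u) -> adj v w) ->
  closed_labeling f.
Proof.
move=> lf H; rewrite /closed_labeling lf /=; apply/forallP => u.
apply/forallP => v; apply/forallP => w; apply/implyP => /and4P[vu uw vw l].
by apply: (H u) => //; rewrite adj_sym.
Qed.

Lemma adj_neq u v : adj u v -> u != v.
Proof. by apply: contraTneq => ->; rewrite adj_irr. Qed.

(** * Label-monotone paths and the umbrella property *)

Definition up f : rel G := [rel u v | adj u v && (f u < f v)].

Lemma connect_up_leq f u v : connect (up f) u v -> f u <= f v.
Proof.
case/connectP => p pp -> {v}; elim: p u pp => [//|x p IHp] u /=.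
by case/andP => /andP[_ /ltnW ux] /IHp; apply: leq_trans.
Qed.

(* A peak or a valley of a walk can be cut off, since the labeling is closed. *)
Lemma connect_up_adjr f u v w : closed_labeling f ->
  connect (up f) u v -> adj v w -> connect (up f) u w || connect (up f) w u.
Proof.
move=> cf /connectP[p pp ->] {v}; elim/last_ind: p w pp => [|p v IHp] w /=.
  move=> _ uw; have [l|l] := boolP (f u < f w).
    by rewrite connect1 // /up /= uw.
  rewrite [connect _ w u]connect1 ?orbT // /up /= adj_sym uw /=.
  by rewrite closed_ltNge // eq_sym adj_neq.
rewrite rcons_path last_rcons => /andP[pp /= /andP[qv lqv]] vw.
have [l|l] := boolP (f v < f w).
  rewrite (connect_trans (y := v)) //; last by rewrite connect1 // /up /= vw.
  apply/connectP; exists (rcons p v); last by rewrite last_rcons.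
  by rewrite rcons_path pp /up /= qv.
have lwv : f w < f v by rewrite closed_ltNge // eq_sym adj_neq.
have [<-|qw] := eqVneq (last u p) w.
  by apply/orP; left; apply/connectP; exists p.
by apply: IHp pp _; apply: (closed_below cf _ vw) => //; rewrite adj_sym.
Qed.

(** If [w] lies above [v], then [v] is a valley between [w] and the next vertex of the path and is
    cut off; otherwise [w] prolongs the path downward. *)
Lemma connect_up_adjl f u v w : closed_labeling f ->
  connect (up f) v u -> adj v w -> connect (up f) u w || connect (up f) w u.
Proof.
move=> cf /connectP[p pp ->] {u}; elim: p v w pp => [|x p IHp] v w /=.
  by move=> _; apply: connect_up_adjr (connect0 _ _).
case/andP=> /andP[vx lvx] pp vw; have [l|l] := boolP (f v < f w).
  have [<-|xw] := eqVneq x w.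
    by apply/orP; right; apply/connectP; exists p.
  by apply: IHp pp _; apply: (closed_above cf vx).
apply/orP; right; apply/connectP; exists (v :: x :: p) => //=.
rewrite /up /= vx lvx pp adj_sym vw !andbT /=.
by rewrite closed_ltNge // eq_sym adj_neq.
Qed.

Lemma connect_up_total f u v : connected G -> closed_labeling f ->
  connect (up f) u v || connect (up f) v u.
Proof.
move=> /andP[_ /forallP/(_ u)/forallP/(_ v)/connectP[p pp ->]] cf {v}.
elim/last_ind: p pp => [|p v IHp] /=; first by rewrite connect0.
rewrite rcons_path last_rcons => /andP[/IHp/orP[c|c] lv].
  exact: connect_up_adjr c lv.
exact: connect_up_adjl c lv.
Qed.

Lemma leq_connect_up f u v : connected G -> closed_labeling f ->
  f u <= f v -> connect (up f) u v.
Proof.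
move=> cG cf l; have /orP[//|c] := connect_up_total u v cG cf.
have <- : u = v; last exact: connect0.
apply: (bij_inj (closed_bij cf)); apply/val_inj/eqP.
by rewrite /= eqn_leq l connect_up_leq.
Qed.

(** The left end of the edge slides along a monotone path from [u] to [v]: the next vertex and [w]
    are both neighbors above the current one, hence adjacent. *)
Lemma umbrella_right f u v w : connected G -> closed_labeling f ->
  adj u w -> f u < f v -> f v < f w -> adj v w.
Proof.
move=> cG cf uw luv; have /connectP[p pp ->] := leq_connect_up cG cf (ltnW luv).
elim: p u uw pp {luv} => [//|x p IHp] u uw /= /andP[/andP[ux lux] pp] lw.
apply: (IHp x) => //.
have lxw : f x < f w.
  by apply: leq_ltn_trans lw; apply: connect_up_leq; apply/connectP; exists p.
apply: (closed_above cf ux uw _ lux (ltn_trans lux lxw)).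
by apply: contraTneq lxw => ->; rewrite ltnn.
Qed.

Lemma umbrella_left f u v w : connected G -> closed_labeling f ->
  adj u w -> f u < f v -> f v < f w -> adj u v.
Proof.
move=> cG cf uw luv lvw; have /connectP[p pp e] := leq_connect_up cG cf (ltnW lvw).
rewrite {}e {w} in uw lvw *.
elim/last_ind: p pp uw {lvw} => [//|p x IHp].
rewrite rcons_path last_rcons => /andP[pp /andP[qx lqx]] ux.
apply: IHp => //.
have luq : f u < f (last v p).
  by apply: leq_trans luv _; apply: connect_up_leq; apply/connectP; exists p.
apply: (closed_below cf _ _ _ (ltn_trans luq lqx) lqx); try by rewrite adj_sym.
by apply: contraTneq luq => <-; rewrite ltnn.
Qed.

(** * Orientation of non-adjacent and of non-exchangeable pairs *)

Definition far : rel G := [rel u v | (u != v) && ~~ adj u v].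

Lemma far_sym : symmetric far.
Proof. by move=> u v; rewrite /far /= eq_sym adj_sym. Qed.

(** An edge between the outer vertices would, by the umbrella property at each end, force one
    between the inner vertices. *)
Lemma far_outward f u v u' v' : connected G -> closed_labeling f ->
  f u < f v -> far u v -> f u' <= f u -> f v <= f v' -> far u' v'.
Proof.
move=> cG cf luv /andP[_ nuv] lu lv.
have inj_f := bij_inj (closed_bij cf).
have luv' : f u' < f v' by apply: leq_ltn_trans lu (leq_trans luv lv).
apply/andP; split; first by apply: contraTneq luv' => ->; rewrite ltnn.
apply: contra nuv => uv'.
have uv1 : adj u v'.
  move: lu; rewrite leq_eqVlt => /orP[/eqP/val_inj/inj_f<- //|lu].
  exact: umbrella_right uv' lu (leq_trans luv lv).
move: lv; rewrite leq_eqVlt => /orP[/eqP/val_inj/inj_f-> //|lv].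
exact: umbrella_left uv1 luv lv.
Qed.

(** If [u] lay between [v] and [w], the umbrella property for the edge [v w] would make [u] adjacent
    to [v]. *)
Lemma far_same_side f u v w : connected G -> closed_labeling f ->
  far u v -> far u w -> adj v w -> (f u < f v) = (f u < f w).
Proof.
move=> cG cf; wlog suff H: v w / far u v -> far u w -> adj v w ->
    f u < f v -> f u < f w.
  move=> uv uw vw; apply/idP/idP; first exact: H.
  by apply: H; rewrite // adj_sym.
move=> /andP[_ nuv] /andP[uw _] vw luv; rewrite closed_ltNge //.
apply: contra nuv => lwu.
by rewrite (umbrella_right cG cf _ lwu luv) // adj_sym.
Qed.

(** Along a [g]-monotone path from [v] to [w] every vertex stays non-adjacent to [u], so in [f]
    consecutive vertices lie on the same side of [u]. *)
Lemma far_up_right f g u v w : connected G ->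
  closed_labeling f -> closed_labeling g ->
  far u v -> g u < g v -> g v <= g w -> (f u < f v) = (f u < f w).
Proof.
move=> cG cf cg uv luv /(leq_connect_up cG cg)/connectP[p pp ->] {w}.
elim: p v uv luv pp => [//|x p IHp] v uv luv /= /andP[/andP[vx lvx] pp].
have lux := ltn_trans luv lvx.
have ux : far u x := far_outward cG cg luv uv (leqnn _) (ltnW lvx).
by rewrite (far_same_side cG cf uv ux vx) (IHp x).
Qed.

Lemma far_up_left f g u v w : connected G ->
  closed_labeling f -> closed_labeling g ->
  far u v -> g u < g v -> g w <= g u -> (f u < f v) = (f w < f v).
Proof.
move=> cG cf cg uv luv /(leq_connect_up cG cg)/connectP[p pp e].
rewrite {}e {u} in uv luv *.
elim/last_ind: p uv luv pp => [//|p x IHp].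
rewrite last_rcons rcons_path => xv lxv /andP[pp /andP[qx lqx]].
have lqv := ltn_trans lqx lxv.
have qv : far (last w p) v := far_outward cG cg lxv xv (ltnW lqx) (leqnn _).
rewrite -(IHp qv lqv pp).
rewrite (closed_ltNge cf (andP xv).1) (closed_ltNge cf (andP qv).1); congr negb.
by apply: (far_same_side cG cf); rewrite 1?far_sym // adj_sym.
Qed.

(** The center of an induced path on three vertices is neither a peak nor a valley. *)
Lemma closed_between f u v w : closed_labeling f ->
  adj v u -> adj v w -> far u w -> (f u < f v) = (f v < f w).
Proof.
move=> cf vu vw /andP[nuw /negP fuw].
have nvu : u != v by rewrite eq_sym adj_neq.
have [l|l] := boolP (f u < f v).
  rewrite (closed_ltNge cf (adj_neq vw)); apply/esym/negP => l'.
  exact/fuw/(closed_below cf vu vw nuw l l').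
apply/esym/negP => l'; apply/fuw/(closed_above cf vu vw nuw _ l').
by rewrite (closed_ltNge cf) ?adj_neq.
Qed.

(* Non-adjacent pairs are oriented by [f] as the two [g]-extremal vertices are;
   an adjacent non-exchangeable pair lies in an induced path on three vertices
   and inherits its orientation from the ends of that path. *)
Lemma closed_orientation f g : connected G ->
  closed_labeling f -> closed_labeling g ->
  exists s : bool, forall u v, ~~ exchangeable u v -> g u < g v ->
    (f u < f v) = s.
Proof.
move=> cG cf cg; have /andP[/card_gt0P[x0 _] _] := cG.
have [m _ hm] := arg_minnP (fun x => g x : nat) (erefl (predT x0)).
have [M _ hM] := arg_maxnP (fun x => g x : nat) (erefl (predT x0)).
exists (f m < f M).
have Hfar u v : far u v -> g u < g v -> (f u < f v) = (f m < f M).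
  move=> uv luv; rewrite (far_up_right cG cf cg uv luv (hM v isT)).
  apply: (far_up_left cG cf cg _ _ (hm u isT)).
    by apply: (far_outward cG cg luv uv) => //; apply: hM.
  by apply: leq_trans luv (hM v isT).
move=> u v nex luv.
have nuv : u != v by apply: contraTneq luv => ->; rewrite ltnn.
have [uv|nuv'] := boolP (adj u v); last by apply: Hfar; rewrite // /far /= nuv.
(* A vertex [w] in only one of the two full neighborhoods completes the edge to an induced path,
   centered at [u] in the first case and at [v] in the second. *)
have : ~~ (full_nbhd u \subset full_nbhd v) || ~~ (full_nbhd v \subset full_nbhd u).
  by rewrite -negb_and -eqEsubset.
case/orP => /subsetPn[w]; rewrite !inE negb_or => a /andP[nw fw].
  have {a} uw : adj u w.
    case/orP: a nw fw uv => [/eqP->|//].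
    by rewrite (adj_sym v) => _ /negbTE->.
  have wv : far w v by rewrite /far /= nw adj_sym.
  have lwu : g w < g u by rewrite (closed_between cg uw uv wv).
  rewrite -(Hfar w v wv (ltn_trans lwu luv)).
  (* [f] orients both edges of the path alike, hence also its pair of ends. *)
  have e := closed_between cf uw uv wv; rewrite -e.
  apply/idP/idP => l; first exact: ltn_trans l (etrans (esym e) l).
  case: (boolP (f w < f u)) e => // l' /esym/negbT; rewrite -leqNgt => l2.
  by move: l'; rewrite (leq_trans l l2).
have {a} vw : adj v w by case/orP: a nw fw uv => [/eqP->|//] _ /negbTE->.
have vu : adj v u by rewrite adj_sym.
have uw : far u w by rewrite /far /= eq_sym nw.
have lvw : g v < g w by rewrite -(closed_between cg vu vw uw).
rewrite -(Hfar u w uw (ltn_trans luv lvw)).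
have e := closed_between cf vu vw uw.
apply/idP/idP => l; first exact: ltn_trans l (etrans (esym e) l).
case: (boolP (f u < f v)) e => // l' /esym/negbT; rewrite -leqNgt => l2.
by move: l'; rewrite (leq_trans l l2).
Qed.

(** * Reversal of labelings *)

Definition rev_labeling (f : {ffun G -> 'I_n}) : {ffun G -> 'I_n} :=
  [ffun v => rev_ord (f v)].

Lemma rev_labelingK : involutive rev_labeling.
Proof. by move=> f; apply/ffunP => v; rewrite !ffunE rev_ordK. Qed.

Lemma rev_labeling_lt (f : {ffun G -> 'I_n}) u v :
  (rev_labeling f u < rev_labeling f v) = (f v < f u).
Proof. by rewrite !ffunE /= ltn_sub2lE. Qed.

Lemma closed_rev_labeling (f : {ffun G -> 'I_n}) :
  closed_labeling f -> closed_labeling (rev_labeling f).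
Proof.
move=> cf; apply: closed_labelingP => [|u v w uv uw vw].
  apply: bij_labeling; have [h hK Kh] := closed_bij cf.
  exists (h \o @rev_ord n) => x; rewrite /= ffunE ?rev_ordK ?hK //.
  by rewrite Kh rev_ordK.
rewrite !rev_labeling_lt => /orP[/andP[]|/andP[]].
  exact: closed_below uv uw vw.
exact: closed_above uv uw vw.
Qed.

End ClosedLabelings.

(** * Exchangeability classes and the quotient graph *)

Section ExchangeableClasses.

Variable G : sgraph.
Implicit Types (u v w x : G).

Lemma exch_class_subproof v :
  [set w in [set: G] | exchangeable v w] \in exch_classes G.
Proof. exact: imset_f. Qed.

Definition exch_class_of v : exch_class G := 
  exist (fun A => A \in exch_classes G) _ (exch_class_subproof v).

Lemma mem_exch_class_of v w :
  (w \in class_set (exch_class_of v)) = exchangeable v w.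
Proof. by rewrite !inE. Qed.

Lemma exch_class_ofP (A : exch_class G) : exists v, A = exch_class_of v.
Proof.
by case: A => A PA; have /imsetP[v _ e] := PA; exists v; apply: val_inj.
Qed.

Lemma eq_exch_class_of u v :
  (exch_class_of u == exch_class_of v) = exchangeable u v.
Proof.
apply/eqP/idP => [e|/eqP e].
  by rewrite -mem_exch_class_of e mem_exch_class_of /exchangeable /=.
by apply/val_inj/setP => w; rewrite !inE /exchangeable /= e.
Qed.

Lemma mem_class_set v (A : exch_class G) :
  (v \in class_set A) = (exch_class_of v == A).
Proof.
have [u ->] := exch_class_ofP A.
by rewrite mem_exch_class_of eq_exch_class_of /exchangeable /= eq_sym.
Qed.

Lemma exchangeable_adj u v w : exchangeable u v -> w != v -> adj u w -> adj v w.
Proof.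
move=> /eqP/setP/(_ w); rewrite !inE => e /negbTE wv uw.
by move: e; rewrite uw orbT wv /= => <-.
Qed.

(** Representatives do not matter: in an edge between two distinct classes each end can be replaced
    by any vertex exchangeable with it. *)
Lemma quotient_adjE u v :
  quotient_adj (exch_class_of u) (exch_class_of v) =
    ~~ exchangeable u v && adj u v.
Proof.
rewrite /quotient_adj eq_exch_class_of; have [//|nuv] := boolP (exchangeable u v).
rewrite !andTb; apply/exists_inP/idP => [[i iu /exists_inP[j jv ij]]|uv].
  rewrite !mem_class_set !eq_exch_class_of in iu jv.
  have nvi : v != i by apply: contraNneq nuv => ->; rewrite /exchangeable /= eq_sym.
  have nvu : v != u by apply: contraNneq nuv => ->; rewrite /exchangeable /= eqxx.
  apply: (exchangeable_adj iu nvu).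
  by rewrite adj_sym; apply: (exchangeable_adj jv); rewrite 1?eq_sym // adj_sym.
exists u; first by rewrite mem_class_set.
by apply/exists_inP; exists v => //; rewrite mem_class_set.
Qed.

Lemma quotient_connected : connected G -> connected (quotient_graph G).
Proof.
move=> /andP[/card_gt0P[x0 _] /forallP cG]; apply/andP; split.
  by apply/card_gt0P; exists (exch_class_of x0).
apply/forallP => A; apply/forallP => B.
have [u ->] := exch_class_ofP A; have [v ->] := exch_class_ofP B.
have /connectP[p pp ->] := forallP (cG u) v.
elim: p u pp => [|x p IHp] u /=; first by rewrite connect0.
case/andP => ux /IHp; apply: connect_trans.
(* An edge inside a class projects to a single vertex, any other edge to an edge of the quotient. *)
have [e|nux] := boolP (exchangeable u x).
  by move: e; rewrite -eq_exch_class_of => /eqP->.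
by apply: connect1; rewrite /adj /= quotient_adjE nux.
Qed.

(** Full neighborhoods of the quotient pull back to those of [G], so equal ones come from
    exchangeable vertices. *)
Lemma mem_quotient_nbhd u v :
  (exch_class_of v \in full_nbhd (exch_class_of u : quotient_graph G))
    = (v \in full_nbhd u).
Proof.
rewrite !inE /adj /= quotient_adjE -/(adj u v) eq_exch_class_of.
have [/eqP/setP/(_ v)|nvu] /= := boolP (exchangeable v u).
  by rewrite !inE eqxx /= => <-.
have -> : (v == u) = false by apply: contraNF nvu => /eqP->; rewrite /exchangeable /=.
by rewrite /exchangeable /= eq_sym nvu.
Qed.

Lemma quotient_collapsed : collapsed (quotient_graph G).
Proof.
move=> A B; have [u ->] := exch_class_ofP A; have [v ->] := exch_class_ofP B.
move=> e; apply/eqP; rewrite eq_exch_class_of; apply/eqP/setP => w.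
by rewrite -!mem_quotient_nbhd e.
Qed.

End ExchangeableClasses.

(** * Counting closed labelings *)

Section Counting.

Variables (G : sgraph) (n r : nat) (phi : G -> 'I_n) (c : G -> 'I_r).
Hypotheses (G_connected : connected G) (phi_closed : closed_labeling phi).
Hypothesis cE : forall u v, (c u == c v) = exchangeable u v.
Hypothesis phi_mono : forall u v, c u < c v -> phi u < phi v.

(** If the center is exchangeable with one of its two neighbors, these are adjacent anyway;
    otherwise [f] compares the center with both as [phi] does. *)
Lemma class_monotone_closed (f : G -> 'I_n) : bijective f ->
  (forall u v, c u < c v -> f u < f v) -> closed_labeling f.
Proof.
move=> bf mf; apply: closed_labelingP => [|u v w uv uw vw l]; first exact: bij_labeling.
have [e|nuv] := boolP (exchangeable u v); first by
  apply: exchangeable_adj e _ uw; rewrite eq_sym.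
have [e|nuw] := boolP (exchangeable u w).
  by rewrite adj_sym; apply: exchangeable_adj e _ uv.
have phiE x : ~~ exchangeable u x ->
    (f u < f x -> phi u < phi x) /\ (f x < f u -> phi x < phi u).
  rewrite -cE => nux; split => l1; apply: phi_mono; move: nux.
    by rewrite -val_eqE /=; case: ltngtP => // /mf; rewrite ltnNge ltnW.
  by rewrite -val_eqE /=; case: ltngtP => // /mf; rewrite ltnNge ltnW.
have [v1 v2] := phiE v nuv; have [w1 w2] := phiE w nuw.
case/orP: l => /andP[lv lw].
  exact: (closed_above phi_closed uv uw vw (v1 lv) (w1 lw)).
exact: (closed_below phi_closed uv uw vw (v2 lv) (w2 lw)).
Qed.

(** Composition with [phi] is a bijection from the class-preserving permutations onto these
    labelings; its inverse sends [f] to [h \o f], with [h] the inverse of [phi]. *)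
Lemma card_class_monotone_labelings :
  #|[set f : {ffun G -> 'I_n} | labeling f &&
      [forall u, forall v, (c u < c v) ==> (f u < f v)]]|
    = \prod_(a < r) #|[set v | c v == a]|`!.
Proof.
rewrite -card_fiber_perms; set P := [set p | _].
have bphi := closed_bij phi_closed; have [h hK Kh] := bphi.
pose F (p : {perm G}) : {ffun G -> 'I_n} := [ffun v => phi (p v)].
have F_inj : injective F.
  move=> p q /ffunP e; apply/permP => v.
  by have := e v; rewrite !ffunE => /(bij_inj bphi).
rewrite -(card_imset _ F_inj); congr #|pred_of_set _|; apply/setP => f.
rewrite inE; apply/andP/imsetP => [[/labeling_bij bf /forallP mf]|[p pP ->]].
  have inj : injective (h \o f) by apply: inj_comp (can_inj Kh) (bij_inj bf).
  exists (perm inj); last by apply/ffunP => v; rewrite ffunE permE /= Kh.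
  rewrite inE; apply/forallP => v; rewrite permE /=; apply/eqP/val_inj.
  apply: (monotone_bij_fiber (c := fun x => c x : nat) bphi bf phi_mono).
    by move=> x y l; apply: (implyP (forallP (mf x) y)).
  by rewrite Kh.
move: pP; rewrite inE => /forallP cp; split.
  apply: bij_labeling; exists (fun k => p^-1 (h k))%g => [v|k]; rewrite ffunE.
    by rewrite hK permK.
  by rewrite permKV Kh.
apply/forallP => u; apply/forallP => v; apply/implyP => l; rewrite !ffunE.
by apply: phi_mono; rewrite (eqP (cp u)) (eqP (cp v)).
Qed.

Lemma card_closed_labelings (x y : G) : c x < c y ->
  #|[set f : {ffun G -> 'I_n} | closed_labeling f]|
    = 2 * \prod_(a < r) #|[set v | c v == a]|`!.
Proof.
move=> lxy; set S := [set f : {ffun _} | _].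
pose A := [set f : {ffun G -> 'I_n} | f x < f y].
have nxy : x != y by apply: contraTneq lxy => ->; rewrite ltnn.
(* Reversal exchanges the closed labelings placing [x] below [y] with the others, whence the factor
   2. *)
have eSD : S :\: A = @rev_labeling G n @^-1: (S :&: A).
  apply/setP => f; rewrite !inE rev_labeling_lt.
  apply/andP/andP => [[nl cf]|[cf l]]; split.
  - exact: closed_rev_labeling.
  - by rewrite (closed_ltNge cf) // eq_sym.
  - by rewrite -leqNgt ltnW.
  - by rewrite -(rev_labelingK f) closed_rev_labeling.
rewrite -(cardsID A S) eSD (card_preimset _ (inv_inj (@rev_labelingK G n))).
rewrite addnn -mul2n -card_class_monotone_labelings.
congr (2 * #|pred_of_set _|); apply/setP => f; rewrite !inE.
apply/andP/andP => [[cf l]|[/labeling_bij bf /forallP mf]]; last first.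
  have mf' u v : c u < c v -> f u < f v by apply/implyP/(forallP (mf u)).
  by split; [apply: class_monotone_closed|apply: mf'].
split; first by case/andP: cf.
have [s hs] := closed_orientation G_connected cf phi_closed.
have nex u v : c u < c v -> ~~ exchangeable u v.
  by rewrite -cE => luv; apply: contraTneq luv => ->; rewrite ltnn.
(* The common orientation is read off the pair [x], [y], on which [f] agrees with [phi]. *)
have sT : s by rewrite -(hs x y) ?nex ?phi_mono.
apply/forallP => u; apply/forallP => v; apply/implyP => luv.
by rewrite (hs u v) ?nex ?phi_mono.
Qed.

End Counting.

Theorem theorem4p3 (G : sgraph) (n : nat) (phi : G -> 'I_n)
    (G_connected : connected G) (phi_closed : closed_labeling phi)
    (r : nat) (E : 'I_r -> exch_class G) (lab : exch_class G -> 'I_r)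
    (EK : cancel E lab) (labK : cancel lab E)
    (E_ordered : forall (a b : 'I_r) (i j : G), a <> b ->
       i \in class_set (E a) -> j \in class_set (E b) -> (phi i < phi j <-> a < b)) :
  [/\ connected (quotient_graph G),
      collapsed (quotient_graph G)
    & @closed_labeling (quotient_graph G) r lab]
  /\ (1 < r ->
      #|[set f : {ffun G -> 'I_n} | closed_labeling f]|
        = 2 * \prod_(a < r) #|class_set (E a)|`!).
Proof.
pose c v := lab (exch_class_of v).
have cE u v : (c u == c v) = exchangeable u v.
  by rewrite (can_eq labK) eq_exch_class_of.
have mono u v : c u < c v -> phi u < phi v.
  move=> l; apply/(E_ordered (c u) (c v)) => //; rewrite ?labK ?mem_class_set //.
  by move=> e; rewrite e ltnn in l.
split; first split.
- exact: quotient_connected.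
- exact: quotient_collapsed.
- apply: closed_labelingP => [|A B C]; first by apply: bij_labeling; exists E.
  have [u ->] := exch_class_ofP A; have [v ->] := exch_class_ofP B.
  have [w ->] := exch_class_ofP C.
  rewrite /adj /= !quotient_adjE eq_exch_class_of.
  (* The order of the classes lifts to the representatives, so closedness of [phi] applies to
     them. *)
  move=> /andP[_ uv] /andP[_ uw] nvw l; rewrite nvw /=.
  have vw : v != w by apply: contraNneq nvw => ->; rewrite /exchangeable /=.
  case/orP: l => /andP[/mono lv /mono lw].
    exact: (closed_above phi_closed uv uw vw lv lw).
  exact: (closed_below phi_closed uv uw vw lv lw).
(* As [r > 1], the indices 0 and 1 exist; [x] and [y] represent these two classes. *)
move=> r1; have [x ex] := exch_class_ofP (E (Ordinal (ltnW r1))).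
have [y ey] := exch_class_ofP (E (Ordinal r1)).
rewrite (card_closed_labelings G_connected phi_closed cE mono (x := x) (y := y)).
  congr (2 * _); apply: eq_bigr => a _; congr (#|pred_of_set _|`!).
  by apply/setP => v; rewrite inE mem_class_set -(can_eq labK) EK.
by rewrite /c -ex -ey !EK.
Qed.
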